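(* Let $\beta\in(0,1]$. Let $(A_{m,n})_{m,n\in\mathbb N}$ be an infinite complex matrix such that there exist constants $C_0>0$ and $\gamma_0\ge 0$, and for every $\gamma>0$ there is a positive constant $C_\gamma$, so that $$|A_{m,n}|\le\begin{cases} C_0\, e^{\gamma_0 n^\beta}, & n>m,\\ C_\gamma\, e^{\gamma(n^\beta-m^\beta)}, & n\le m,\end{cases}\qquad m,n\in\mathbb N.$$ Then $\mathcal A$ is a continuous operator from $\mathfrak s^\beta$ into $\mathfrak s^\beta$.
   Context: $\mathbb N=\{1,2,\dots\}$. For a matrix $(A_{m,n})_{m,n\in\mathbb N}$, $\mathcal A$ denotes the linear map $(c_n)_{n=1}^\infty\mapsto (a_m)_{m=1}^\infty$ with $a_m=\sum_{n=1}^\infty A_{m,n}c_n$; saying that $\mathcal A$ is a continuous operator from one sequence space into another includes the assertion that these series converge for all sequences in the domain. For $\beta\in(0,1]$, $\mathfrak s^\beta$ is the Fréchet space of complex sequences $(a_n)_{n=1}^\infty$ with $\sup_{n\in\mathbb N}|a_n|e^{kn^\beta}<\infty$ for all $k\in\mathbb N_0=\mathbb N\cup\{0\}$, topologized by these norms. *)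

(* Defs.v *)
From HB Require Import structures.
From mathcomp Require Import all_boot all_order all_algebra.
From mathcomp Require Import complex.
From mathcomp Require Import all_classical all_reals all_analysis.

Set Implicit Arguments.
Unset Strict Implicit.
Unset Printing Implicit Defensive.

Import Order.TTheory GRing.Theory Num.Theory numFieldNormedType.Exports.
Export complex.ComplexField.Normc.

Local Open Scope classical_set_scope.
Local Open Scope ring_scope.

(* Complex sequences are functions nat -> R[i]^o, where index n stands for the
   n.+1-st term: indices are shifted by one, so that the value n^beta attached
   to a positive integer is (n.+1)^beta here. The type R[i]^o carries the usual
   topology of the complex numbers and [normc] is the R-valued modulus. *)
Definition ipow (R : realType) (b : R) (n : nat) : R := n.+1%:R `^ b.

Definition weighted (R : realType) (b : R) (k : nat) (a : nat -> R[i]^o)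
    (n : nat) : R :=
  normc (a n) * expR (k%:R * ipow b n).

Definition snorm (R : realType) (b : R) (k : nat) (a : nat -> R[i]^o) : R :=
  sup (range (weighted b k a)).

Definition rapid (R : realType) (b : R) : {pred nat -> R[i]^o} :=
  mem [set a : nat -> R[i]^o | forall k, has_ubound (range (weighted b k a))].

(* The space s^beta; membership in [rapid b] says that all the suprema
   [snorm b k a] are finite (sup is only meaningful for bounded sets). *)
Record sspace (R : realType) (b : R) := Sspace {
  sseq :> nat -> R[i]^o ;
  sseq_rapid : sseq \in rapid b }.

HB.instance Definition _ (R : realType) (b : R) := [isSub for @sseq R b].
HB.instance Definition _ (R : realType) (b : R) :=
  [Choice of sspace b by <:].

Section sspace_lmod.
Variables (R : realType) (b : R).
Implicit Types a c : nat -> R[i]^o.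

Lemma normc_ge0 (z : R[i]) : 0 <= normc z.
Proof. by case: z => x y; exact: sqrtr_ge0. Qed.

Lemma weighted_ge0 k a n : 0 <= weighted b k a n.
Proof. by rewrite mulr_ge0 ?normc_ge0 ?expR_ge0. Qed.

Lemma rapidP a :
  reflect (forall k, exists M, forall n, weighted b k a n <= M) (a \in rapid b).
Proof.
apply: (iffP idP) => [|h]; rewrite inE /=.
  by move=> h k; have [M hM] := h k; exists M => n; apply: hM; exists n.
by move=> k; have [M hM] := h k; exists M => _ [n _ <-].
Qed.

Lemma weightedD k a c n :
  weighted b k (a + c) n <= weighted b k a n + weighted b k c n.
Proof. by rewrite /weighted -mulrDl ler_pM2r ?expR_gt0// le_normcD. Qed.

Lemma weightedZ k (z : R[i]) a n :
  weighted b k (z *: a) n = normc z * weighted b k a n.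
Proof. by rewrite /weighted mulrA -normcM. Qed.

Lemma weighted0 k n : weighted b k 0 n = 0.
Proof. by rewrite /weighted normc0 mul0r. Qed.

Lemma rapid_submod_closed : submod_closed (rapid b).
Proof.
split; first by apply/rapidP => k; exists 0 => n; rewrite weighted0.
move=> z a c /rapidP ha /rapidP hc; apply/rapidP => k.
have [[M hM] [N hN]] := (ha k, hc k); exists (normc z * M + N) => n.
apply: (le_trans (weightedD _ _ _ _)).
by rewrite lerD// weightedZ ler_wpM2l ?normc_ge0.
Qed.

HB.instance Definition _ :=
  GRing.isSubmodClosed.Build _ _ (rapid b) rapid_submod_closed.
HB.instance Definition _ := [SubChoice_isSubLmodule of sspace b by <:].

End sspace_lmod.

Section sspace_norms.
Variables (R : realType) (b : R).
Implicit Types u v w : sspace b.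

Lemma weighted_le_snorm k u n : weighted b k u n <= snorm b k u.
Proof.
apply: ub_le_sup; last by exists n.
by move: (sseq_rapid u); rewrite inE; exact.
Qed.

Lemma snorm_le k u M : (forall n, weighted b k u n <= M) -> snorm b k u <= M.
Proof.
by move=> h; apply: ge_sup => [|_ [n _ <-]]; first by exists (weighted b k u 0), 0.
Qed.

Lemma snorm_ge0 k u : 0 <= snorm b k u.
Proof. exact: le_trans (weighted_ge0 _ _ _ 0) (weighted_le_snorm k u 0). Qed.

Lemma ler_snormD k u v : snorm b k (u + v) <= snorm b k u + snorm b k v.
Proof.
apply: (@snorm_le k (u + v)) => n; apply: (le_trans (weightedD _ _ _ _ _)).
by rewrite lerD ?weighted_le_snorm.
Qed.

Lemma ler_snormZ k (z : R[i]) u : snorm b k (z *: u) <= normc z * snorm b k u.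
Proof.
apply: (@snorm_le k (z *: u)) => n; rewrite [leLHS]weightedZ.
by rewrite ler_wpM2l ?normc_ge0 ?weighted_le_snorm.
Qed.

Lemma snorm0 k : snorm b k (0 : sspace b) = 0.
Proof.
apply/eqP; rewrite eq_le snorm_ge0 andbT.
by apply: (@snorm_le k 0) => n; rewrite [leLHS]weighted0.
Qed.

Lemma snorm_distC k u v : snorm b k (u - v) = snorm b k (v - u).
Proof.
suff h x y : snorm b k (x - y : sspace b) <= snorm b k (y - x : sspace b).
  by apply/eqP; rewrite eq_le !h.
rewrite -opprB -scaleN1r; apply: (le_trans (ler_snormZ _ _ _)).
by rewrite normcN normc1 mul1r.
Qed.

Definition sball (u : sspace b) (K : nat) (e : R) : set (sspace b) :=
  [set v : sspace b | forall k, (k <= K)%N -> snorm b k (v - u) < e].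

(* The locally convex topology generated by the norms snorm b k, k : nat: a
   neighbourhood of u contains a ball for finitely many of the norms. *)
Definition snbhs (u : sspace b) : set_system (sspace b) :=
  [set U | exists K e, 0 < e /\ sball u K e `<=` U].

HB.instance Definition _ := hasNbhs.Build (sspace b) snbhs.

Lemma snbhsE u U :
  nbhs u U <-> exists K e, 0 < e /\ sball u K e `<=` U.
Proof. by []. Qed.

Lemma sball_center u K e : 0 < e -> sball u K e u.
Proof. by move=> e0 k _; rewrite subrr snorm0. Qed.

Lemma sball_split u v w K d e :
  sball u K d v -> sball v K e w -> sball u K (d + e) w.
Proof.
move=> uv vw k kK; rewrite -(subrKA v) addrC.
by apply: le_lt_trans (ler_snormD _ _ _) _; rewrite ltrD ?uv ?vw.
Qed.

Fact snbhs_filter u : ProperFilter (nbhs u).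
Proof.
split; first by move=> [K [e [e0 /(_ u)]]]; apply; exact: sball_center.
split; first by exists 0, 1.
  move=> U V [K [d [d0 hU]]] [L [e [e0 hV]]].
  exists (maxn K L), (Num.min d e); split; first by rewrite lt_min d0.
  by move=> v hv; split; [apply: hU|apply: hV] => k kK;
    have := hv k; rewrite leq_max kK ?orbT => /(_ isT);
    rewrite lt_min => /andP[].
by move=> U V UV [K [e [e0 hU]]]; exists K, e; split=> // v /hU /UV.
Qed.

Fact snbhs_singleton u U : nbhs u U -> U u.
Proof. by move=> [K [e [e0]]]; apply; exact: sball_center. Qed.

Fact snbhs_nbhs u U : nbhs u U -> nbhs u (nbhs^~ U).
Proof.
move=> [K [e [e0 hU]]]; exists K, (e / 2); split; first by rewrite divr_gt0.
move=> v uv; exists K, (e / 2); split; first by rewrite divr_gt0.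
by move=> w vw; apply: hU; rewrite [e]splitr; exact: sball_split vw.
Qed.

HB.instance Definition _ := Nbhs_isNbhsTopological.Build (sspace b)
  snbhs_filter snbhs_singleton snbhs_nbhs.

Lemma sball_open u K e : open (sball u K e).
Proof.
rewrite openE => v uv; rewrite /interior.
suff [d d0 hd] : exists2 d : R, 0 < d &
    forall k, (k <= K)%N -> snorm b k (v - u) + d <= e.
  exists K, d; split; first exact: d0.
  move=> w vw k kK; apply: lt_le_trans (hd _ kK).
  rewrite -(subrKA v) addrC.
  by apply: le_lt_trans (ler_snormD _ _ _) _; rewrite ltrD2l vw.
elim: K uv => [|K IH] uv.
  exists (e - snorm b 0 (v - u)); first by rewrite subr_gt0 uv.
  by move=> k; rewrite leqn0 => /eqP ->; rewrite addrC subrK.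
have [|d d0 hd] := IH; first by move=> k kK; apply: uv; exact: leqW.
exists (Num.min d (e - snorm b K.+1 (v - u))).
  by rewrite lt_min d0 subr_gt0 uv.
move=> k; rewrite leq_eqVlt => /predU1P[->|kK].
  by rewrite addrC -lerBrDr ge_min lexx orbT.
by apply: le_trans (hd _ kK); rewrite lerD2l ge_min lexx.
Qed.

Fact sspace_add_continuous :
  continuous (fun x : sspace b * sspace b => x.1 + x.2).
Proof.
move=> [u v] U /= [K [e [e0 hU]]].
have e2 : 0 < e / 2 by rewrite divr_gt0.
exists (sball u K (e / 2), sball v K (e / 2)).
  by split; exists K, (e / 2); split.
move=> [x y] /= [xu yv]; apply: hU => k kK; rewrite [e]splitr.
rewrite opprD addrACA.
by apply: le_lt_trans (ler_snormD _ _ _) _; rewrite ltrD ?xu ?yv.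
Qed.

Lemma snorm_bound K u : exists2 M : R, 0 < M &
  forall k, (k <= K)%N -> snorm b k u <= M.
Proof.
elim: K => [|K [M M0 hM]].
  exists (snorm b 0 u + 1); first by rewrite ltr_wpDl ?snorm_ge0.
  by move=> k; rewrite leqn0 => /eqP ->; rewrite lerDl.
exists (Num.max M (snorm b K.+1 u)); first by rewrite lt_max M0.
move=> k; rewrite leq_eqVlt => /predU1P[->|kK]; first by rewrite le_max lexx orbT.
by rewrite le_max hM.
Qed.

Fact sspace_scale_continuous :
  continuous (fun x : R[i]^o * sspace b => x.1 *: x.2).
Proof.
move=> [z u] U /= [K [e [e0 hU]]].
have [M M0 hM] := snorm_bound K u.
have e2 : 0 < e / 2 by rewrite divr_gt0.
set d := Num.min 1 (e / 2 / M).
have d0 : 0 < d by rewrite lt_min ltr01 divr_gt0.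
have z0 : 0 < normc (z : R[i]) + 1 by rewrite ltr_wpDl ?normc_ge0.
exists (ball z (d%:C)%C, sball u K (e / 2 / (normc (z : R[i]) + 1))).
  split => /=; first by apply: (@nbhsx_ballx _ _ z); rewrite ltcR.
  by exists K, (e / 2 / (normc (z : R[i]) + 1)); split; rewrite ?divr_gt0.
move=> [y v] /= [zy uv]; apply: hU => k kK.
have {}zy : normc (y - z : R[i]) < d.
  by rewrite -normcN opprB -ltcR; exact: zy.
have yz : normc (y : R[i]) <= normc (z : R[i]) + 1.
  rewrite -[X in normc X](subrK (z : R[i])) addrC.
  rewrite (le_trans (le_normcD _ _))// lerD2l ltW// (lt_le_trans zy)//.
  by rewrite ge_min lexx.
have -> : y *: v - z *: u = y *: (v - u) + (y - z : R[i]) *: u.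
  by rewrite scalerBr scalerBl addrA subrK.
apply: le_lt_trans (ler_snormD _ _ _) _; rewrite [e]splitr ltr_leD//.
  apply: le_lt_trans (ler_snormZ _ _ _) _.
  apply: (@le_lt_trans _ _ ((normc (z : R[i]) + 1) * snorm b k (v - u))).
    by rewrite ler_wpM2r ?snorm_ge0.
  by rewrite mulrC -ltr_pdivlMr// uv.
apply: le_trans (ler_snormZ _ _ _) _.
apply: (@le_trans _ _ (e / 2 / M * M)); last by rewrite divfK ?gt_eqF.
rewrite ler_pM ?normc_ge0 ?snorm_ge0 ?hM// ltW// (lt_le_trans zy)//.
by rewrite ge_min lexx orbT.
Qed.

Let convex_lt (s e x y : R) :
  0 <= s -> 0 <= 1 - s -> x < e -> y < e -> s * x + (1 - s) * y < e.
Proof.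
move=> s0 s1 xe ye; have [->|sn0] := eqVneq s 0.
  by rewrite mul0r add0r subr0 mul1r.
rewrite [ltRHS](_ : _ = s * e + (1 - s) * e); last first.
  by rewrite -mulrDl addrC subrK mul1r.
have sp : 0 < s by rewrite lt_neqAle eq_sym sn0.
by rewrite ltr_leD ?ltr_pM2l ?ler_wpM2l ?(ltW ye).
Qed.

Fact sspace_locally_convex : exists2 B : set_system (sspace b),
  (forall U, U \in B -> convex_set (U : set (convex_lmodType (sspace b)))) &
  basis B.
Proof.
exists [set U | exists u K e, U = sball u K e]; last first.
  split=> [_ [u [K [e ->]]]|u U [K [e [e0 hU]]]]; first exact: sball_open.
  exists (sball u K e) => //; split; last exact: sball_center.
  by exists u, K, e.
move=> _ /set_mem[u [K [e ->]]] x y t /set_mem ux /set_mem uy.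
apply/mem_set => k kK.
have -> : conv t x y - u =
    t%:num *: (x - u : sspace b) + (1 - t%:num) *: (y - u : sspace b).
  rewrite [conv t x y](_ : _ = t%:num *: x + (1 - t%:num) *: y :> sspace b) //.
  rewrite !scalerBr addrACA -opprD -scalerDl.
  by rewrite (addrC t%:num) subrK scale1r.
apply: le_lt_trans (ler_snormD _ _ _) _.
have [] : 0 <= t%:num /\ t%:num <= 1 :> R[i] by split.
move: (t%:num) => s s0 s1.
have sE : s = ((normc s)%:C)%C by rewrite -[LHS]ger0_norm.
have s1E : normc (1 - s) = 1 - normc s.
  have /ger0_norm hs : 0 <= 1 - s by rewrite subr_ge0.
  by apply: complexI; rewrite rmorphB/= -sE -[RHS]hs.
have ns1 : 0 <= 1 - normc s by rewrite -s1E normc_ge0.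
have hx := ux _ kK; have hy := uy _ kK.
have := ler_snormZ k s (x - u : sspace b).
have := ler_snormZ k (1 - s) (y - u : sspace b).
rewrite s1E => h1 h2; apply: le_lt_trans (lerD h2 h1) _.
exact: (convex_lt (normc_ge0 s) ns1 hx hy).
Qed.

(* The factory below only yields the uniform structure, hence the three
   instances after it. *)
HB.instance Definition _ := PreTopologicalLmod_isTvs.Build R[i] (sspace b)
  sspace_add_continuous sspace_scale_continuous sspace_locally_convex.
HB.instance Definition _ := PreTopologicalNmodule_isTopologicalNmodule.Build
  (sspace b) sspace_add_continuous.
HB.instance Definition _ := TopologicalNmodule_isTopologicalLmodule.Build R[i]
  (sspace b) sspace_scale_continuous.
HB.instance Definition _ := Uniform_isTvs.Build R[i] (sspace b)
  sspace_locally_convex.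

End sspace_norms.

(* Main.v *)
(* Write p_n = n^beta. Choosing gamma = k + 1, both cases of the hypothesis give
   |A_{m,n}| e^{k p_m} <= C e^{K p_n} with K depending only on k: for n > m
   because p_m <= p_n, and for n <= m because e^{gamma (p_n - p_m)} absorbs
   e^{k p_m}. As sum_n e^{-p_n} is finite, the series defining the m-th entry of
   the image of c converges absolutely, and its sum times e^{k p_m} is bounded
   by a multiple of the (K+1)-th norm of c, uniformly in m. *)
Require Import Defs.
From HB Require Import structures.
From mathcomp Require Import all_boot all_order all_algebra.
From mathcomp Require Import complex.
From mathcomp Require Import all_classical all_reals all_analysis.
From mathcomp Require Import ring lra.
Import Order.TTheory GRing.Theory Num.Theory numFieldNormedType.Exports.
Local Open Scope classical_set_scope.
Local Open Scope ring_scope.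

(** * Moduli, limits and series of complex numbers *)

Lemma normc_le_ReIm {R : realType} (z : R[i]) :
  normc z <= `|complex.Re z| + `|complex.Im z|.
Proof.
case: z => x y /=; rewrite -[leRHS]ger0_norm ?addr_ge0// -sqrtr_sqr.
rewrite ler_wsqrtr// sqrrD !real_normK ?num_real//.
by have := mulr_ge0 (normr_ge0 x) (normr_ge0 y); lra.
Qed.

Lemma normr_Re_le {R : realType} (z : R[i]) : `|complex.Re z| <= normc z.
Proof.
by case: z => x y /=; rewrite -sqrtr_sqr ler_wsqrtr// lerDl sqr_ge0.
Qed.

Lemma normr_Im_le {R : realType} (z : R[i]) : `|complex.Im z| <= normc z.
Proof.
by case: z => x y /=; rewrite -sqrtr_sqr ler_wsqrtr// lerDr sqr_ge0.
Qed.

Lemma normc_sum {R : realType} (f : nat -> R[i]) n :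
  normc (\sum_(0 <= i < n) f i) <= \sum_(0 <= i < n) normc (f i).
Proof.
elim: n => [|n IH]; first by rewrite !big_geq// normc0.
rewrite !big_nat_recr//=; apply: le_trans (le_normcD _ _) _.
by rewrite lerD2r.
Qed.

(** The norm on [R[i]^o] is itself complex-valued, so its epsilons are positive elements of [R[i]].
    Each of these equals its own modulus, which allows passing to epsilons in [R]. *)
Lemma cvg_normcP {R : realType} {u : nat -> R[i]^o} {l : R[i]^o} :
  u @ \oo --> l <->
  forall e : R, 0 < e -> \forall n \near \oo, normc (l - u n) < e.
Proof.
split=> [/cvgrPdist_lt h e e0|h].
  have /h : 0 < (e%:C)%C by rewrite ltcR.
  by apply: filterS => n; rewrite -ltcR.
apply/cvgrPdist_lt => e e0.
have eE : e = ((normc e)%:C)%C by rewrite -[LHS]ger0_norm ?ltW.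
have : 0 < normc e by rewrite -ltcR -eE.
by move=> /h; apply: filterS => n; rewrite -ltcR -eE.
Qed.

Lemma cvg_ReIm {R : realType} {u : nat -> R[i]^o} {x y : R} :
  (fun n => complex.Re (u n)) @ \oo --> x ->
  (fun n => complex.Im (u n)) @ \oo --> y ->
  u @ \oo --> (Complex x y : R[i]^o).
Proof.
move=> /cvgrPdist_lt hx /cvgrPdist_lt hy; apply/cvg_normcP => e e0.
have e2 : 0 < e / 2 by rewrite divr_gt0.
apply: filterS2 (hx _ e2) (hy _ e2) => n h1 h2.
apply: le_lt_trans (normc_le_ReIm _) _.
by move: h1 h2; case: (u n) => v w /= h1 h2; rewrite [e]splitr ltrD.
Qed.

Lemma normc_lim_le {R : realType} {u : nat -> R[i]^o} {l : R[i]^o} {M : R} :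
  u @ \oo --> l -> (forall n, normc (u n) <= M) -> normc l <= M.
Proof.
move=> /cvg_normcP ul uM; apply/ler_addgt0Pr => e /ul[n _ /(_ n (leqnn n))/= h].
rewrite -[X in normc X](subrK (u n : R[i])) addrC.
by apply: le_trans (le_normcD _ _) _; rewrite lerD// ltW.
Qed.

Lemma is_cvg_series_ler {R : realType} {f g : nat -> R} {M : R} :
  (forall n, `|f n| <= g n) -> (forall n, \sum_(0 <= i < n) g i <= M) ->
  cvgn (series f).
Proof.
move=> fg gM; apply: normed_cvg; apply: nondecreasing_is_cvgn.
  by apply: nondecreasing_series => i _ _; exact: normr_ge0.
exists M => _ [n _ <-]; apply: le_trans (gM n).
by apply: ler_sum => i _; exact: fg.
Qed.

(** Real and imaginary parts are dominated by the modulus, so both real series converge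
    absolutely. *)
Lemma normc_bounded_series_cvg {R : realType} {f : nat -> R[i]^o} {M : R} :
  (forall n, \sum_(0 <= i < n) normc (f i) <= M) -> cvgn (series f).
Proof.
move=> fM.
have hr : cvgn (series (fun n => complex.Re (f n))).
  by apply: is_cvg_series_ler fM => n; exact: normr_Re_le.
have hi : cvgn (series (fun n => complex.Im (f n))).
  by apply: is_cvg_series_ler fM => n; exact: normr_Im_le.
apply/cvg_ex; eexists; apply: cvg_ReIm.
  rewrite (_ : (fun n => _) = series (fun n => complex.Re (f n))); first exact: hr.
  by apply/funext => n; rewrite /series/= raddf_sum.
rewrite (_ : (fun n => _) = series (fun n => complex.Im (f n))); first exact: hi.
by apply/funext => n; rewrite /series/= raddf_sum.
Qed.

(** * Summability of exp(-n^beta) *)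

(** The right-hand side telescopes: its increment 2/((n+1)(n+2)) is at least 1/(n+1)^2, with
    difference n/((n+1)^2 (n+2)). *)
Lemma sum_inv_sqr_le (R : realType) n :
  \sum_(0 <= i < n) (i.+1%:R ^+ 2)^-1 <= 2 - 2 / n.+1%:R :> R.
Proof.
elim: n => [|n IH]; first by rewrite big_geq// divr1 subrr.
rewrite big_nat_recr//=; apply: le_trans (lerD IH (lexx _)) _.
have : 0 <= n%:R :> R by [].
rewrite -(natr1 n.+1) -(natr1 n); move: (n%:R : R) => x x0.
have x1 : x + 1 != 0 by lra.
have x2 : x + 1 + 1 != 0 by lra.
rewrite -subr_ge0 [leRHS](_ : _ = x / ((x + 1) ^+ 2 * (x + 1 + 1))).
  by rewrite divr_ge0// mulr_ge0 ?sqr_ge0//; lra.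
by field; rewrite x1 x2.
Qed.

Lemma ipow_ge0 {R : realType} (b : R) n : 0 <= ipow b n.
Proof. exact: powR_ge0. Qed.

(* [expR p >= p ^+ q.+1 / q.+1`!], with [q] so large that
   [p ^+ q.+1 >= n.+1 ^+ 2] for [p = ipow b n]. *)
Lemma sum_expRN_ipow_le {R : realType} {b : R} : 0 < b ->
  exists2 S : R, 0 <= S &
    forall n, \sum_(0 <= i < n) expR (- ipow b i) <= S.
Proof.
move=> b0; pose q := Num.bound (2 / b).
have bq : 2 <= b * q.+1%:R.
  rewrite mulrC -ler_pdivrMr// ltW//.
  apply: lt_trans (archi_boundP _) _; first by rewrite divr_ge0// ltW.
  by rewrite ltr_nat.
exists (2 * (q.+1)`!%:R) => [|n]; first by rewrite mulr_ge0.
apply: (@le_trans _ _ (\sum_(0 <= i < n) (i.+1%:R ^+ 2)^-1 * (q.+1)`!%:R)).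
  apply: ler_sum => i _; rewrite expRN -[leRHS]invrK invfM invrK.
  rewrite lef_pV2 ?posrE ?expR_gt0//.
  apply: le_trans (expR_ge1Dxn q (ipow_ge0 b i)).
  rewrite ler_wpDl// ler_wpM2r// /ipow -!powR_mulrn ?powR_ge0// -powRrM.
  by rewrite ler_powR// ler1n.
rewrite -mulr_suml ler_wpM2r//; apply: le_trans (sum_inv_sqr_le _ n) _.
by rewrite gerBl divr_ge0.
Qed.

(** * Continuity of linear maps from norm estimates *)

Lemma weighted_leq {R : realType} {b : R} {j k : nat} a n : (j <= k)%N ->
  weighted b j a n <= weighted b k a n.
Proof.
move=> jk; rewrite ler_wpM2l ?normc_ge0// ler_expR ler_wpM2r ?ipow_ge0//.
by rewrite ler_nat.
Qed.

Lemma snorm_leq {R : realType} {b : R} {j k : nat} (u : sspace b) :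
  (j <= k)%N -> snorm b j u <= snorm b k u.
Proof.
move=> jk; apply: snorm_le => n.
exact: le_trans (weighted_leq _ _ jk) (weighted_le_snorm _ _ _).
Qed.

(** A ball tests the norms of all indices up to [k]; as the norms increase with the index, an
    estimate of the [k]-th one controls them all. *)
Lemma linear_snorm_continuous {R : realType} {b : R}
    (T : {linear sspace b -> sspace b}) :
  (forall k, exists L (B : R), forall c, snorm b k (T c) <= B * snorm b L c) ->
  continuous T.
Proof.
move=> hT u U /= [k [e [e0 hU]]].
have [L [B hB]] := hT k.
(* The sign of [B] is unknown, so the radius is divided by a positive majorant of [B]. *)
have B0 : 0 < `|B| + 1 by rewrite ltr_wpDl.
exists L, (e / (`|B| + 1)); split; first by rewrite divr_gt0.
move=> v uv; apply: hU => j jk; rewrite -linearB.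
apply: le_lt_trans (snorm_leq _ jk) _.
apply: le_lt_trans (hB _) _.
apply: (@le_lt_trans _ _ ((`|B| + 1) * snorm b L (v - u))).
  by rewrite ler_wpM2r ?snorm_ge0// ler_wpDr// ler_norm.
by rewrite mulrC -ltr_pdivlMr// uv.
Qed.

(** * The operator of a matrix under a single weighted bound *)

Section matrix_operator.
Variables (R : realType) (b : R) (A : nat -> nat -> R[i]^o).
Hypothesis b0 : 0 < b.
Hypothesis hA : forall k : nat, exists K (C : R), 0 <= C /\ forall m n,
  normc (A m n) * expR (k%:R * ipow b m) <= C * expR (K%:R * ipow b n).

(** Uniformity in [n] gives absolute convergence (take [k = 0]), and uniformity in [m] bounds the
    norms of the image. *)
Lemma matrix_series_bound k : exists L (B : R), forall (c : sspace b) m n,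
  (\sum_(0 <= i < n) normc (A m i * c i)) * expR (k%:R * ipow b m)
    <= B * snorm b L c.
Proof.
have [K [C [C0 hC]]] := hA k.
have [S S0 hS] := sum_expRN_ipow_le b0.
exists K.+1, (C * S) => c m n; rewrite mulr_suml mulrAC.
apply: (@le_trans _ _ (\sum_(0 <= i < n)
    C * snorm b K.+1 c * expR (- ipow b i))); last first.
  by rewrite -mulr_sumr ler_wpM2l ?mulr_ge0 ?snorm_ge0.
apply: ler_sum => i _; rewrite normcM mulrAC.
apply: (@le_trans _ _ (C * expR (K%:R * ipow b i) * normc (c i))).
  by rewrite ler_wpM2r ?normc_ge0.
rewrite -!mulrA ler_wpM2l//.
(* Using the norm of index [K.+1] instead of [K] leaves the summable factor [expR (- ipow b i)]. *)
have := weighted_le_snorm K.+1 c i; rewrite /weighted => h.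
apply: le_trans (ler_wpM2r (expR_ge0 _) h).
by rewrite -mulrA -expRD mulrC -natr1 mulrDl mul1r addrK.
Qed.

Lemma matrix_series_cvg (c : sspace b) m :
  cvgn (series (fun n => A m n * c n)).
Proof.
have [L [B hB]] := matrix_series_bound 0.
apply: (@normc_bounded_series_cvg R _ (B * snorm b L c)) => n.
by have := hB c m n; rewrite mul0r expR0 mulr1.
Qed.

(** [limn] has a default value on divergent sequences; by [matrix_series_cvg] it is the true sum
    here. *)
Definition matrix_apply (c : sspace b) (m : nat) : R[i]^o :=
  limn (series (fun n => A m n * c n)).

Lemma matrix_apply_bound k : exists L (B : R), forall c m,
  weighted b k (matrix_apply c) m <= B * snorm b L c.
Proof.
have [L [B hB]] := matrix_series_bound k; exists L, B => c m.
rewrite /weighted -ler_pdivlMr ?expR_gt0//.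
apply: normc_lim_le (matrix_series_cvg c m) _ => n.
rewrite ler_pdivlMr ?expR_gt0//; apply: le_trans (hB c m n).
by rewrite ler_wpM2r ?expR_ge0// normc_sum.
Qed.

Lemma matrix_apply_rapid c : matrix_apply c \in rapid b.
Proof.
apply/rapidP => k; have [L [B hB]] := matrix_apply_bound k.
by exists (B * snorm b L c) => m; exact: hB.
Qed.

Definition matrix_op (c : sspace b) : sspace b :=
  Sspace (matrix_apply_rapid c).

Lemma matrix_op_linear : linear matrix_op.
Proof.
move=> z c d; apply: val_inj; apply/funext => m /=.
apply/cvg_lim => //.
rewrite (_ : series _ = z *: series (fun n => A m n * c n)
    + series (fun n => A m n * d n)).
  apply: cvgD (matrix_series_cvg d m).
  by apply: cvgZr; exact: matrix_series_cvg.
apply/funext => n.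
rewrite [RHS](_ : _ = z *: (\sum_(0 <= i < n) A m i * c i)
    + \sum_(0 <= i < n) A m i * d i)// scaler_sumr -big_split.
by apply: eq_bigr => i _; rewrite mulrDr mulrCA.
Qed.

Lemma matrix_op_continuous :
  exists T : {linear sspace b -> sspace b}, continuous T /\
    forall (c : sspace b) (m : nat),
      series (fun n => A m n * c n) @ \oo --> (T c m : R[i]^o).
Proof.
pose T : {linear sspace b -> sspace b} :=
  HB.pack matrix_op (GRing.isLinear.Build _ _ _ _ _ matrix_op_linear).
exists T; split=> [|c m]; last exact: matrix_series_cvg.
apply: linear_snorm_continuous => k.
have [L [B hB]] := matrix_apply_bound k.
by exists L, B => c; apply: snorm_le => m; exact: hB.
Qed.

End matrix_operator.

(** * Merging the two growth bounds *)

Theorem corollary3p8 (R : realType) (b : R) (hb0 : 0 < b) (hb1 : b <= 1)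
    (A : nat -> nat -> R[i]^o)
    (hA : exists C0 g0 : R, [/\ 0 < C0, 0 <= g0 &
      forall g : R, 0 < g -> exists2 Cg : R, 0 < Cg &
        forall m n : nat, normc (A m n) <=
          if (m < n)%N then C0 * expR (g0 * ipow b n)
          else Cg * expR (g * (ipow b n - ipow b m))]) :
  exists T : {linear sspace b -> sspace b}, continuous T /\
    forall (c : sspace b) (m : nat),
      series (fun n => A m n * c n) @ \oo --> (T c m : R[i]^o).
Proof.
apply: matrix_op_continuous => // k.
have [C0 [g0 [C0_gt0 g0_ge0 hA']]] := hA.
(* Taking gamma = k + 1 rather than k keeps it positive when [k = 0]. *)
have [Cg Cg_gt0 {}hA'] := hA' k.+1%:R (ltr0Sn _ k).
have Ck : 0 <= C0 + Cg by rewrite addr_ge0// ltW.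
(* The exponent dominates both k + gamma_0, needed for m < n, and k + 1, needed for n <= m. *)
exists (k.+1 + Num.bound g0)%N, (C0 + Cg); split=> // m n.
apply: le_trans (ler_wpM2r (expR_ge0 _) (hA' m n)) _.
have p0 j := ipow_ge0 b j.
have g0b := ltW (archi_boundP g0_ge0).
rewrite natrD -natr1; case: ltnP => mn; rewrite -mulrA -expRD.
  rewrite ler_pM ?expR_ge0 ?(ltW C0_gt0) ?lerDl ?(ltW Cg_gt0)// ler_expR.
  have pmn : ipow b m <= ipow b n.
    by apply: ge0_ler_powR; rewrite ?nnegrE ?ler_nat ?(ltW hb0)// ltnW.
  have := ler_wpM2l (ler0n R k) pmn.
  have := ler_wpM2r (p0 n) g0b.
  by have := p0 n; lra.
(* For n <= m the exponent is (k+1)(p_n - p_m) + k p_m = (k+1) p_n - p_m. *)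
rewrite ler_pM ?expR_ge0 ?(ltW Cg_gt0) ?lerDr ?(ltW C0_gt0)// ler_expR.
have := mulr_ge0 (ler0n R (Num.bound g0)) (p0 n).
by have := p0 m; lra.
Qed.
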